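(* Let $n\ge p\ge 1$, let $x_1,\ldots,x_n\in\mathbb{R}^p$ be fixed vectors such that $\Sigma_n=n^{-1}\sum_{i=1}^n x_ix_i^{\rm t}$ has full rank, and let $y_i=x_i^{\rm t}\beta+\varepsilon_i$ for $i=1,\ldots,n$, with $\beta\in\mathbb{R}^p$ and $\varepsilon_1,\ldots,\varepsilon_n$ i.i.d. $N(0,\sigma^2)$, $\sigma>0$. For a subset $S$ of $\{1,\ldots,p\}$ let $${\rm risk}_S={\rm E}\,\frac1n\sum_{i=1}^n\{x_{i,S}^{\rm t}\hat\beta_S-x_i^{\rm t}\beta\}^2,$$ and let ${\rm risk}_{\rm wide}$ be the same quantity for $S=\{1,\ldots,p\}$. Then $${\rm rr}_S=\frac{{\rm risk}_S}{{\rm risk}_{\rm wide}}=\frac{|S|+\gamma_S}{p},\qquad \gamma_S=n\beta_{S^c}^{\rm t}Q_S^{-1}\beta_{S^c}/\sigma^2 .$$ In particular, ${\rm risk}_S\le{\rm risk}_{\rm wide}$ if and only if $\gamma_S\le p-|S|$.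
   Context: For $u\in\mathbb{R}^p$ and $S\subseteq\{1,\ldots,p\}$, $u_S$ denotes the subvector of entries $u_j$ with $j\in S$, and $S^c$ is the complement of $S$. The matrix $\Sigma_n$ is blocked according to indices inside $S$ (block index 0) and outside $S$ (block index 1): $\Sigma_{00,S}$ is the submatrix with rows and columns in $S$, $\Sigma_{01,S}$ has rows in $S$ and columns in $S^c$, $\Sigma_{10,S}=\Sigma_{01,S}^{\rm t}$, and $\Sigma_{11,S}$ has rows and columns in $S^c$. The submodel least squares estimator is $\hat\beta_S=\Sigma_{00,S}^{-1}n^{-1}\sum_{i=1}^n x_{i,S}y_i$. The matrix $Q_S$ is defined by $Q_S^{-1}=\Sigma_{11,S}-\Sigma_{10,S}\Sigma_{00,S}^{-1}\Sigma_{01,S}$. Terms involving empty index sets are read as zero. Expectations are under the full model $y_i=x_i^{\rm t}\beta+\varepsilon_i$. *)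

(* Defs.v *)
From HB Require Import structures.
From mathcomp Require Import all_boot all_order all_algebra.
From mathcomp Require Import all_classical all_reals all_analysis.

Set Implicit Arguments.
Unset Strict Implicit.
Unset Printing Implicit Defensive.

Import Order.TTheory GRing.Theory Num.Theory.

Local Open Scope classical_set_scope.
Local Open Scope ring_scope.

(** Mutual independence: the product rule holds over every subfamily. *)
Definition mutually_independent (d : measure_display) (T : measurableType d)
    (R : realType) (P : probability T R) (n : nat)
    (X : 'I_n -> {RV P >-> R}) : Prop :=
  forall (J : {set 'I_n}) (B : 'I_n -> set R),
    (forall i, measurable (B i)) ->
    P (\bigcap_(i in [set` J]) (X i @^-1` B i))
    = (\prod_(i in J) P (X i @^-1` B i))%E.

(** The second parameter of [normal_prob] is the standard deviation. *)
Definition iid_normal (d : measure_display) (T : measurableType d)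
    (R : realType) (P : probability T R) (n : nat) (m s : R)
    (X : 'I_n -> {RV P >-> R}) : Prop :=
  mutually_independent X /\
  forall (i : 'I_n) (A : set R), measurable A ->
    distribution P (X i) A = normal_prob m s A.

Definition dotv (R : realType) (k : nat) (u v : 'cV[R]_k) : R :=
  (u^T *m v) 0 0.

(** Entries are listed in increasing order of index; [enum_val] enumerates the
    elements of [S]. *)
Definition subvec (R : realType) (p : nat) (S : {set 'I_p}) (u : 'cV[R]_p) :
  'cV[R]_#|S| := \col_(j < #|S|) u (enum_val j) 0.

Definition submat (R : realType) (p : nat) (S S' : {set 'I_p}) (M : 'M[R]_p) :
  'M[R]_(#|S|, #|S'|) :=
  \matrix_(i < #|S|, j < #|S'|) M (enum_val i) (enum_val j).

Definition Sigma (R : realType) (n p : nat) (x : 'I_n -> 'cV[R]_p) : 'M[R]_p :=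
  n%:R^-1 *: \sum_(i < n) x i *m (x i)^T.

Definition Sigma00 (R : realType) (n p : nat) (x : 'I_n -> 'cV[R]_p)
  (S : {set 'I_p}) : 'M[R]_#|S| := submat S S (Sigma x).

Definition Sigma01 (R : realType) (n p : nat) (x : 'I_n -> 'cV[R]_p)
  (S : {set 'I_p}) : 'M[R]_(#|S|, #|~: S|) := submat S (~: S) (Sigma x).

Definition Sigma10 (R : realType) (n p : nat) (x : 'I_n -> 'cV[R]_p)
  (S : {set 'I_p}) : 'M[R]_(#|~: S|, #|S|) := (Sigma01 x S)^T.

Definition Sigma11 (R : realType) (n p : nat) (x : 'I_n -> 'cV[R]_p)
  (S : {set 'I_p}) : 'M[R]_#|~: S| := submat (~: S) (~: S) (Sigma x).

Definition Qmat (R : realType) (n p : nat) (x : 'I_n -> 'cV[R]_p)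
  (S : {set 'I_p}) : 'M[R]_#|~: S| :=
  invmx (Sigma11 x S - Sigma10 x S *m invmx (Sigma00 x S) *m Sigma01 x S).

Definition betahat (R : realType) (n p : nat) (x : 'I_n -> 'cV[R]_p)
  (S : {set 'I_p}) (y : 'I_n -> R) : 'cV[R]_#|S| :=
  invmx (Sigma00 x S) *m (n%:R^-1 *: \sum_(i < n) y i *: subvec S (x i)).

Definition risk (d : measure_display) (T : measurableType d) (R : realType)
    (P : probability T R) (n p : nat) (x : 'I_n -> 'cV[R]_p)
    (beta : 'cV[R]_p) (y : 'I_n -> T -> R) (S : {set 'I_p}) : \bar R :=
  'E_P[fun w : T => n%:R^-1 * \sum_(i < n)
         (dotv (subvec S (x i)) (betahat x S (fun k => y k w))
          - dotv (x i) beta) ^+ 2].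

Definition risk_wide (d : measure_display) (T : measurableType d)
    (R : realType) (P : probability T R) (n p : nat) (x : 'I_n -> 'cV[R]_p)
    (beta : 'cV[R]_p) (y : 'I_n -> T -> R) : \bar R :=
  risk P x beta y [set: 'I_p]%SET.

(** A quotient of extended reals: for [S] the full index set, an equality
    [rr = 1] already forces [risk_wide] to be finite and nonzero. *)
Definition rr (d : measure_display) (T : measurableType d) (R : realType)
    (P : probability T R) (n p : nat) (x : 'I_n -> 'cV[R]_p)
    (beta : 'cV[R]_p) (y : 'I_n -> T -> R) (S : {set 'I_p}) : \bar R :=
  (risk P x beta y S / risk_wide P x beta y)%E.

Definition gamma (R : realType) (n p : nat) (x : 'I_n -> 'cV[R]_p)
    (beta : 'cV[R]_p) (sigma : R) (S : {set 'I_p}) : R :=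
  n%:R * dotv (subvec (~: S) beta) (invmx (Qmat x S) *m subvec (~: S) beta)
  / sigma ^+ 2.

(* Main.v *)
(** The residual of the submodel fit at observation [i] is
    [sum_k H_ik eps_k + b_i], where [H] is the hat matrix of the submodel, an
    orthogonal projection of rank [|S|], and [b = (H - 1) X beta] is the bias.
    Since [H] fixes the columns of [X_S], only [X_{S^c} beta_{S^c}] contributes
    to [b], and [|b|^2 = n beta_{S^c}^t Q_S^{-1} beta_{S^c}], where [Q_S^{-1}]
    is the Schur complement of [Sigma_00,S].  The errors are uncorrelated with
    variance [sigma^2], so that
    [n risk_S = sigma^2 tr (H H^t) + |b|^2 = sigma^2 (|S| + gamma_S)];
    for [S] full, [gamma_S = 0].

    The second moment of the normal law comes from the antiderivative
    [s^2 (G x - x phi x)] of [x^2 phi x], where [phi] is the density and [G]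
    its distribution function. *)
Require Import Defs.
From HB Require Import structures.
From mathcomp Require Import all_boot all_order all_algebra.
From mathcomp Require Import all_classical all_reals all_analysis.
From mathcomp Require Import measurable_realfun ring lra.

Set Implicit Arguments.
Unset Strict Implicit.
Unset Printing Implicit Defensive.

Import Order.TTheory GRing.Theory Num.Theory.
Import numFieldNormedType.Exports.

Local Open Scope classical_set_scope.
Local Open Scope ring_scope.

(** * Moments of the normal law *)

(** The normal law is dominated by Lebesgue measure, and its Radon-Nikodym derivative agrees almost
    everywhere with [normal_pdf m s], since both have the same integral over every measurable
    set. *)
Lemma ge0_integral_normal_prob (R : realType) (m s : R) (f : R -> R) :
  measurable_fun [set: R] f -> (forall x, 0 <= f x) ->
  (\int[normal_prob m s]_x (f x)%:E =
   \int[lebesgue_measure]_x (f x * normal_pdf m s x)%:E)%E.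
Proof.
move=> mf f0; have dom := normal_prob_dominates m s.
rewrite -(Radon_Nikodym_SigmaFinite.change_of_variables dom)//; last first.
  exact/measurable_EFinP.
under [RHS]eq_integral do rewrite EFinM.
have mpdf : measurable_fun [set: R] (fun x => (normal_pdf m s x)%:E).
  by apply/measurable_EFinP; exact: measurable_normal_pdf.
have iRN := Radon_Nikodym_SigmaFinite.f_integrable dom.
apply: ae_eq_integral => //.
- apply: emeasurable_funM; first exact/measurable_EFinP.
  exact: measurable_int iRN.
- by apply: emeasurable_funM => //; exact/measurable_EFinP.
- apply: ae_eqe_mul2l; apply: integral_ae_eq => // E _ mE.
  by rewrite -Radon_Nikodym_SigmaFinite.f_integral.
Qed.

Lemma ge0_integral_opp (R : realType) (g : R -> R) :
  measurable_fun [set: R] g -> (forall x, 0 <= g x) ->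
  (\int[lebesgue_measure]_x (g (- x))%:E =
   \int[lebesgue_measure]_x (g x)%:E)%E.
Proof.
move=> mg g0; pose N : measurableTypeR R -> measurableTypeR R := -%R.
have mN : measurable_fun [set: measurableTypeR R] N by exact: oppr_measurable.
transitivity (\int[pushforward lebesgue_measure N]_x (EFin \o g) x)%E.
  rewrite ge0_integral_pushforward//; first exact/measurable_EFinP.
  by move=> x _ /=; rewrite lee_fin.
by apply: eq_measure_integral => A mA _; exact: lebesgue_measureN.
Qed.

(** Folding the line at 0 reduces integrals of even functions to a half-line, where the fundamental
    theorem of calculus is applied. *)
Lemma ge0_integral_itvy_opp (R : realType) (g : R -> R) :
  measurable_fun [set: R] g -> (forall x, 0 <= g x) ->
  (\int[lebesgue_measure]_x (g x)%:E =
   \int[lebesgue_measure]_(x in `[0%R, +oo[) (g (- x))%:E +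
   \int[lebesgue_measure]_(x in `[0%R, +oo[) (g x)%:E)%E.
Proof.
move=> mg g0.
rewrite -(setUv `[0%R, +oo[%classic) ge0_integral_setU//=; last 4 first.
- exact: measurableC.
- by apply/measurable_EFinP; rewrite setUv.
- by move=> x _; rewrite lee_fin.
- exact/disj_setPCl.
rewrite addeC; congr +%E; rewrite setCitvr.
rewrite integral_itv_bndo_bndc; last exact/measurable_EFinP/measurable_funTS.
rewrite (@ge0_integration_by_substitution0 _ (fun x => (g (- x))%:E))//.
- by under [RHS]eq_integral do rewrite opprK.
- by apply/measurable_EFinP; exact: measurableT_comp.
- by move=> x; rewrite lee_fin.
Qed.

Lemma normal_pdfN (R : realType) (s x : R) :
  s != 0 -> normal_pdf 0 s (- x) = normal_pdf 0 s x.
Proof. by move=> s0; rewrite normal_pdfE// /normal_fun !subr0 sqrrN. Qed.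

Lemma is_derive_normal_pdf (R : realType) (s x : R) : s != 0 ->
  is_derive x 1 (normal_pdf 0 s) (- (x / s ^+ 2) * normal_pdf 0 s x).
Proof.
move=> s0; rewrite normal_pdfE// /normal_fun.
(* Rewritten with function-level operations, the density has a derivative that instance resolution
   can compute. *)
rewrite (_ : (fun _ => _) = normal_peak s \*:
    (expR \o ((- (s ^+ 2 *+ 2)^-1) \*: (id ^+ 2 : R -> R)))); last first.
  apply/funext => z /=; congr (_ * expR _).
  rewrite -[(id ^+ 2) z]/(z ^+ 2) subr0 /GRing.scale/=.
  by rewrite !mulNr [in LHS]mulrC.
apply: is_derive_eq; rewrite /GRing.scale/= -[(id ^+ 2) x]/(x ^+ 2) subr0.
rewrite -[_ *: x ^+ 2]/(_ * x ^+ 2).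
rewrite (_ : - x ^+ 2 / _ = - (s ^+ 2 *+ 2)^-1 * x ^+ 2); last first.
  by rewrite !mulNr mulrC.
by field.
Qed.

(** With [u = x ^+ 2 / (s ^+ 2 *+ 2)], the inequality [1 + u <= expR u] gives [expR (- u) <= u^-1],
    which squeezes the product below a constant multiple of [x^-1]. *)
Lemma cvg_mul_normal_pdfy (R : realType) (s : R) : s != 0 ->
  x * normal_pdf 0 s x @[x --> +oo] --> (0 : R).
Proof.
move=> s0; have pk0 := normal_peak_ge0 s.
apply: (@squeeze_cvgr _ _ _ _ (cst 0)
  (fun x => normal_peak s * (s ^+ 2 *+ 2) * x^-1)).
- near=> x.
  have x0 : 0 < x by near: x; exact: nbhs_pinfty_gt.
  apply/andP; split; first by rewrite mulr_ge0 ?normal_pdf_ge0 ?ltW.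
  rewrite normal_pdfE// mulrCA -[leRHS]mulrA.
  rewrite ler_wpM2l// /normal_fun subr0 mulNr expRN.
  have u0 : 0 < x ^+ 2 / (s ^+ 2 *+ 2).
    by rewrite divr_gt0// ?exprn_gt0// pmulrn_lgt0// exprn_even_gt0.
  rewrite (_ : s ^+ 2 *+ 2 / x = x * (x ^+ 2 / (s ^+ 2 *+ 2))^-1); last first.
    by field; rewrite s0 gt_eqF.
  rewrite ler_pM2l// lef_pV2 ?posrE ?expR_gt0//.
  by apply: le_trans (expR_ge1Dx _); rewrite lerDr.
- exact: cvg_cst.
- rewrite -[X in _ --> X](mulr0 (normal_peak s * (s ^+ 2 *+ 2))).
  apply: cvgM; first exact: cvg_cst.
  apply/gtr0_cvgV0; last exact: cvg_id.
  exact: nbhs_pinfty_gt.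
Unshelve. all: end_near. Qed.

Lemma integral_sqr_normal_pdf (R : realType) (s : R) : s != 0 ->
  (\int[lebesgue_measure]_x (x ^+ 2 * normal_pdf 0 s x)%:E = (s ^+ 2)%:E)%E.
Proof.
move=> s0; set mu := lebesgue_measure.
have cphi := @continuous_normal_pdf R 0 s s0.
have phi_ge0 x : 0 <= normal_pdf 0 s x by exact: normal_pdf_ge0.
pose G x := (\int[mu]_(t in `]-oo, x]) normal_pdf 0 s t)%R.
have iphi x : mu.-integrable `]-oo, x] (EFin \o normal_pdf 0 s).
  exact: integrableS (integrable_normal_pdf 0 s).
have GE x : (G x)%:E = (\int[mu]_(t in `]-oo, x]) (normal_pdf 0 s t)%:E)%E.
  by rewrite /G /Rintegral fineK//; exact: integrable_fin_num.
have dG (x : R) : is_derive x (1 : R) G (normal_pdf 0 s x).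
  (* The endpoint [x + 1] is an arbitrary point to the right of [x]. *)
  have [] := @continuous_FTC1 R (normal_pdf 0 s) -oo%O x (x + 1).
  - by rewrite ltrDl.
  - exact: iphi.
  - by rewrite ltNyr.
  - exact: cphi.
  by move=> dG <-; rewrite derive1E; exact: DeriveDef.
have Gy : G x @[x --> +oo] --> (1 : R).
  suff : EFin \o G @ +oo --> (1%:E : \bar R) by move/fine_cvg.
  (* The identity, as a random variable on the line under the normal law, has [G] as its
     distribution function; this yields the limit 1. *)
  pose idR : measurableTypeR R -> R := idfun.
  pose mid := isMeasurableFun.Build _ _ _ _ idR (@measurable_id _ _ setT).
  pose X : {RV normal_prob 0 s >-> R} := HB.pack idR mid.
  have := cvg_cdfy1 X.
  by apply: cvg_trans; apply: near_eq_cvg; near=> x; rewrite /= GE.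
have mphi : measurable_fun [set: R] (normal_pdf 0 s).
  exact: measurable_normal_pdf.
(* By evenness of the density, the total mass 1 splits into two equal halves. *)
have G0 : G 0 + G 0 = 1.
  apply: EFin_inj; rewrite EFinD -(integral_normal_pdf 0 s).
  rewrite ge0_integral_itvy_opp// GE.
  under eq_integral do rewrite -normal_pdfN//.
  rewrite -(@ge0_integration_by_substitution0 _ (EFin \o normal_pdf 0 s))//.
  - by under [in RHS]eq_integral do rewrite normal_pdfN//.
  - exact/measurable_EFinP.
pose F x := s ^+ 2 * (G x - x * normal_pdf 0 s x).
have dF (x : R) : is_derive x (1 : R) F (x ^+ 2 * normal_pdf 0 s x).
  have ? := is_derive_normal_pdf x s0.
  rewrite (_ : F = s ^+ 2 \*: (G - id * normal_pdf 0 s)) //.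
  by apply: is_derive_eq; rewrite /GRing.scale/=; field.
have cF (x : R) : {for x, continuous F}.
  by apply/differentiable_continuous/derivable1_diffP; exact: ex_derive.
have cf : continuous (fun x : R => x ^+ 2 * normal_pdf 0 s x).
  by move=> x; apply: cvgM; [exact: exprn_continuous|exact: cphi].
rewrite ge0_integral_itvy_opp//; last 2 first.
- exact: continuous_measurable_fun.
- by move=> x; rewrite mulr_ge0// sqr_ge0.
under eq_integral do rewrite sqrrN normal_pdfN//.
(* [F] tends to [s ^+ 2] at infinity and [F 0] is half of that, so each of the two half-lines
   contributes [s ^+ 2 / 2]. *)
rewrite (@ge0_continuous_FTC2y _ _ F 0 (s ^+ 2)).
- rewrite -EFinB -EFinD; congr EFin.
  have -> : F 0 = s ^+ 2 * (1 / 2) by rewrite /F mul0r subr0; congr *%R; lra.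
  by field.
- by move=> x _; rewrite mulr_ge0// sqr_ge0.
- exact: continuous_subspaceT.
- rewrite (_ : s ^+ 2 = s ^+ 2 * (1 - 0)); last by rewrite subr0 mulr1.
  apply: cvgM; first exact: cvg_cst.
  by apply: cvgB => //; exact: cvg_mul_normal_pdfy.
- by move=> x _; exact: ex_derive.
- apply: cvg_at_right_filter; exact: cF.
- by move=> x _; rewrite derive1E; exact: derive_val.
Unshelve. all: end_near. Qed.

Lemma ge0_expectation_normal (d : measure_display) (T : measurableType d)
    (R : realType) (P : probability T R) (m s : R) (X : {RV P >-> R})
    (f : R -> R) :
  (forall A : set R, measurable A -> distribution P X A = normal_prob m s A) ->
  measurable_fun [set: R] f -> (forall x, 0 <= f x) ->
  (\int[P]_w (f (X w))%:E =
   \int[lebesgue_measure]_x (f x * normal_pdf m s x)%:E)%E.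
Proof.
move=> dX mf f0; rewrite -ge0_integral_normal_prob//.
(* [normal_prob] is a measure on [measurableTypeR R], whereas [distribution P X]
   lives on the canonical measurable structure of [R]: the measurable sets agree
   but the displays differ, so [X] is retyped. *)
pose Y : T -> measurableTypeR R := X.
have mY : measurable_fun [set: T] Y by exact: measurable_funPT X.
have mEf : measurable_fun [set: measurableTypeR R] (EFin \o f).
  exact/measurable_EFinP.
transitivity (\int[pushforward P Y]_x (EFin \o f) x)%E.
  by rewrite ge0_integral_pushforward// => x _ /=; rewrite lee_fin.
by apply: eq_measure_integral => A mA _; exact: dX.
Qed.

Section centered_normal.
Context (d : measure_display) (T : measurableType d) (R : realType).
Context (P : probability T R) (s : R) (X : {RV P >-> R}).
Hypothesis s0 : s != 0.
Hypothesis dX :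
  forall A : set R, measurable A -> distribution P X A = normal_prob 0 s A.

Lemma expectation_sqr_normal : ('E_P[fun w => (X w ^+ 2)%R] = (s ^+ 2)%:E)%E.
Proof.
rewrite unlock (ge0_expectation_normal (f := fun x => x ^+ 2) dX).
- exact: integral_sqr_normal_pdf.
- exact: measurable_funX.
- by move=> x; exact: sqr_ge0.
Qed.

Lemma normal_Lfun2 : (X : T -> R) \in Lfun P 2%:E.
Proof.
rewrite inE; apply/andP; split; rewrite inE//=.
rewrite /finite_norm unlock /Lnorm poweR_lty//=.
under eq_integral do rewrite powR_mulrn// real_normK ?num_real//.
by have := expectation_sqr_normal; rewrite unlock => ->; rewrite ltry.
Qed.

Lemma normal_Lfun1 : (X : T -> R) \in Lfun P 1.
Proof.
by apply: Lfun_subset12 normal_Lfun2; exact: fin_num_measure.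
Qed.

(** The positive and negative parts of [X] have the same integral because the density is even, and
    they cancel because that integral is finite. Splitting comes first since the passage to the
    density is stated for nonnegative functions. *)
Lemma expectation_normal : ('E_P[X] = 0)%E.
Proof.
have max_ge0 (x : R) : 0 <= Num.max x 0 by rewrite le_max lexx orbT.
have E (g : R -> R) : measurable_fun [set: R] g ->
  (\int[P]_w (Num.max (g (X w)) 0)%:E =
    \int[lebesgue_measure]_x (Num.max (g x) 0 * normal_pdf 0 s x)%:E)%E.
  move=> mg; pose gp x := Num.max (g x) 0.
  apply: (ge0_expectation_normal (f := gp) dX) => [|x].
    exact: measurable_maxr.
  exact: max_ge0.
have -> : ('E_P[X] = \int[P]_w (Num.max (X w) 0)%:E
                     - \int[P]_w (Num.max (- X w) 0)%:E)%E.
  rewrite unlock integralE.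
  congr (_ - _)%E; apply: eq_integral => w _.
    by rewrite unlock /= EFin_max.
  by rewrite unlock /= EFin_max.
rewrite (E id)// (E -%R)//.
rewrite -(@ge0_integral_opp _ (fun x => Num.max (- x) 0 * normal_pdf 0 s x)).
- under [X in (_ - X)%E]eq_integral do rewrite opprK normal_pdfN//.
  rewrite -(E id)// subee//.
  have /Lfun1_integrable/integrable_funepos := normal_Lfun1.
  move=> /(_ measurableT) /(integrable_fin_num measurableT).
  by under eq_integral do rewrite funeposE/= -EFin_max.
- apply: measurable_funM; last exact: measurable_normal_pdf.
  by apply: measurable_maxr => //; exact: oppr_measurable.
- by move=> x; rewrite mulr_ge0// normal_pdf_ge0.
Qed.

End centered_normal.

(** The joint law of [(X, Y)] and the product of the marginals agree on rectangles, hence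
    everywhere; Fubini then factors the integral of the product. *)
Lemma expectationM_indep (d : measure_display) (T : measurableType d)
    (R : realType) (P : probability T R) (X Y : {RV P >-> R}) :
  (forall A B : set R, measurable A -> measurable B ->
    P (X @^-1` A `&` Y @^-1` B) = (P (X @^-1` A) * P (Y @^-1` B))%E) ->
  (X : T -> R) \in Lfun P 1 -> (Y : T -> R) \in Lfun P 1 ->
  (X \* Y : T -> R) \in Lfun P 1 ->
  ('E_P[(X \* Y)%R] = 'E_P[X] * 'E_P[Y])%E.
Proof.
move=> indep /Lfun1_integrable iX /Lfun1_integrable iY /Lfun1_integrable iXY.
pose XY w := (X w, Y w); pose f (z : R * R) : \bar R := (z.1 * z.2)%:E.
have mXY : measurable_fun [set: T] XY by exact: measurable_fun_pair.
have mf : measurable_fun [set: R * R] f.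
  by apply/measurable_EFinP; exact: measurable_funM.
have muE : forall A, measurable A ->
    (distribution P X \x distribution P Y)%E A = pushforward P XY A.
  apply: product_measure_unique => A B mA mB.
  exact: indep.
have if' : (distribution P X \x distribution P Y)%E.-integrable [set: R * R] f.
  have /integrableP[_ oo] := integrable_pushforward mXY mf iXY measurableT.
  apply/integrableP; split => //.
  by rewrite (eq_measure_integral (pushforward P XY))// => A mA _; exact: muE.
rewrite unlock.
transitivity (\int[pushforward P XY]_z f z)%E.
  by rewrite integral_pushforward.
rewrite (eq_measure_integral (distribution P X \x distribution P Y)%E);
  last by move=> A mA _; exact/esym/muE.
rewrite -integral12_prod_meas1//= /fubini_F/=.
have mE : measurable_fun [set: R] (fun x : R => x%:E) by exact/measurable_EFinP.
have idY : (distribution P Y).-integrable [set: R] (fun x : R => x%:E).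
  exact: (@integrable_pushforward _ _ _ _ _ Y (measurable_funPT Y) P setT _ mE).
have idX : (distribution P X).-integrable [set: R] (fun x : R => x%:E).
  exact: (@integrable_pushforward _ _ _ _ _ X (measurable_funPT X) P setT _ mE).
have EYE : (\int[distribution P Y]_y y%:E = \int[P]_w (Y w)%:E)%E.
  by rewrite integral_distribution.
have EXE : (\int[distribution P X]_y y%:E = \int[P]_w (X w)%:E)%E.
  by rewrite integral_distribution.
rewrite /f/=.
under eq_integral do (under eq_integral do rewrite EFinM).
under eq_integral do rewrite integralZl// EYE.
rewrite -EXE.
(* The mean of [Y] is finite, so it can be pulled out of the outer integral as a real constant. *)
have /fineK <- : (\int[P]_w (Y w)%:E)%E \is a fin_num.
  exact: integrable_fin_num iY.
by rewrite integralZr.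
Qed.

(** * Linear algebra of least squares *)

Lemma dotvE (R : realType) (k : nat) (u v : 'cV[R]_k) :
  dotv u v = \sum_(i < k) u i 0 * v i 0.
Proof. by rewrite /dotv mxE; apply: eq_bigr => i _; rewrite mxE. Qed.

Lemma dotv_self_eq0 (R : realType) (k : nat) (u : 'cV[R]_k) :
  dotv u u = 0 -> u = 0.
Proof.
rewrite dotvE => /eqP; rewrite psumr_eq0 => [/allP u0|i _]; last first.
  by rewrite -expr2 sqr_ge0.
apply/colP => i; have := u0 i; rewrite mem_index_enum => /(_ isT).
by rewrite mulf_eq0 orbb mxE => /eqP.
Qed.

Section least_squares.
Context (R : realType) (n p : nat) (x : 'I_n -> 'cV[R]_p).
Implicit Types S : {set 'I_p}.

Definition design S : 'M[R]_(n, #|S|) :=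
  \matrix_(i < n, j < #|S|) x i (enum_val j) 0.

Lemma submat_SigmaE S S' :
  submat S S' (Sigma x) = n%:R^-1 *: ((design S)^T *m design S').
Proof.
apply/matrixP => i j; rewrite !mxE summxE; congr *%R.
by apply: eq_bigr => k _; rewrite !mxE big_ord1 !mxE.
Qed.

Lemma dotv_split S (u v : 'cV[R]_p) :
  dotv u v = dotv (subvec S u) (subvec S v)
             + dotv (subvec (~: S) u) (subvec (~: S) v).
Proof.
rewrite !dotvE (bigID (mem S))/=; congr +%R.
  by rewrite big_enum_val/=; apply: eq_bigr => i _; rewrite !mxE.
rewrite (eq_bigl (mem (~: S))) => [|i]; last by rewrite !inE.
by rewrite big_enum_val/=; apply: eq_bigr => i _; rewrite !mxE.
Qed.

Lemma design_mulE S (u : 'cV[R]_#|S|) i :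
  (design S *m u) i 0 = dotv (subvec S (x i)) u.
Proof. by rewrite dotvE mxE; apply: eq_bigr => j _; rewrite !mxE. Qed.

Hypothesis n0 : (0 < n)%N.
Hypothesis hx : \rank (Sigma x) = p.

Let nR0 : n%:R != 0 :> R. Proof. by rewrite pnatr_eq0 -lt0n. Qed.

Lemma design_inj S (u : 'cV[R]_#|S|) : design S *m u = 0 -> u = 0.
Proof.
(* [v] extends [u] by zero outside [S]; every [dotv (x i) v] then vanishes, so [v] lies in the
   kernel of the invertible [Sigma x]. *)
move=> Du0; pose v : 'cV[R]_p :=
  \col_j \sum_(k < #|S| | enum_val k == j) u k 0.
have vS : subvec S v = u.
  apply/colP => k; rewrite !mxE (bigD1 k)//= big1 ?addr0// => l.
  by case/andP => /eqP/enum_val_inj ->; rewrite eqxx.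
have vC : subvec (~: S) v = 0.
  apply/colP => k; rewrite !mxE big1// => l /eqP lk.
  by have := enum_valP k; rewrite inE -lk enum_valP.
have xv i : dotv (x i) v = 0.
  rewrite (dotv_split S) vS vC [X in _ + X]/dotv mulmx0 mxE addr0.
  by rewrite -design_mulE Du0 mxE.
have Sv : Sigma x *m v = 0.
  rewrite /Sigma -scalemxAl mulmx_suml big1 ?scaler0// => i _.
  rewrite -mulmxA (_ : (x i)^T *m v = 0) ?mulmx0//.
  by apply/matrixP => a b; rewrite !ord1 [RHS]mxE; exact: xv.
have Su : Sigma x \in unitmx by rewrite -row_free_unit /row_free hx.
have v0 : v = 0 by rewrite -(mulKmx Su v) Sv mulmx0.
by rewrite -vS v0; apply/colP => k; rewrite !mxE.
Qed.

(** Up to the factor [n%:R^-1] this is a Gram matrix: a kernel vector [u] makes the squared norm of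
    [design S *m u^T] vanish, and [design S] is injective. The transpose appears because [kermx] is
    a left kernel. *)
Lemma Sigma00_unit S : Sigma00 x S \in unitmx.
Proof.
rewrite -unitmx_tr -row_free_unit -kermx_eq0.
apply/eqP/row_matrixP => i; rewrite row0.
set u := row i _.
have : u *m (Sigma00 x S)^T = 0 by apply/sub_kermxP; exact: row_sub.
rewrite /Sigma00 submat_SigmaE linearZ/= trmx_mul trmxK -scalemxAr => /eqP.
rewrite scaler_eq0 invr_eq0 (negbTE nR0)/= => /eqP uD0.
have : dotv (design S *m u^T) (design S *m u^T) = 0.
  by rewrite /dotv trmx_mul trmxK mulmxA -(mulmxA u) uD0 mul0mx mxE.
move=> /dotv_self_eq0/design_inj/(congr1 trmx).
by rewrite trmxK trmx0.
Qed.

(** Orthogonal projection onto the column span of [design S]; the factor [n%:R^-1] compensates for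
    the normalisation of [Sigma00]. *)
Definition hat_matrix S : 'M[R]_n :=
  n%:R^-1 *: (design S *m invmx (Sigma00 x S) *m (design S)^T).

Lemma hat_matrixE S (y : 'I_n -> R) i :
  dotv (subvec S (x i)) (betahat x S y) = \sum_(k < n) hat_matrix S i k * y k.
Proof.
rewrite -design_mulE /betahat.
have -> : \sum_(k < n) y k *: subvec S (x k) = (design S)^T *m \col_k y k.
  apply/colP => j; rewrite summxE mxE; apply: eq_bigr => k _.
  by rewrite !mxE mulrC.
rewrite -!scalemxAr !mulmxA scalemxAl -/(hat_matrix S) mxE.
by apply: eq_bigr => k _; rewrite [X in _ * X]mxE.
Qed.

Lemma gram_designE S : (design S)^T *m design S = n%:R *: Sigma00 x S.
Proof. by rewrite /Sigma00 submat_SigmaE scalerA divff// scale1r. Qed.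

Lemma trmx_Sigma00 S : (Sigma00 x S)^T = Sigma00 x S.
Proof. by rewrite /Sigma00 submat_SigmaE linearZ/= trmx_mul trmxK. Qed.

Lemma trmx_hat_matrix S : (hat_matrix S)^T = hat_matrix S.
Proof.
by rewrite /hat_matrix linearZ/= !trmx_mul trmxK trmx_inv trmx_Sigma00 mulmxA.
Qed.

Lemma hat_matrix_design S : hat_matrix S *m design S = design S.
Proof.
rewrite /hat_matrix -scalemxAl -mulmxA gram_designE -scalemxAr scalerA.
by rewrite mulVf// scale1r -mulmxA mulVmx ?mulmx1//; exact: Sigma00_unit.
Qed.

Lemma hat_matrix_idem S : hat_matrix S *m hat_matrix S = hat_matrix S.
Proof.
by rewrite {2 3}/hat_matrix -scalemxAr !mulmxA hat_matrix_design.
Qed.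

Lemma mxtrace_hat_matrix S : \tr (hat_matrix S) = #|S|%:R.
Proof.
rewrite /hat_matrix mxtraceZ mxtrace_mulC mulmxA gram_designE -scalemxAl.
by rewrite mulmxV ?Sigma00_unit// mxtraceZ mxtrace1 mulrA mulVf// mul1r.
Qed.

(** For a symmetric idempotent H, the sum of squared entries is tr(H H^t) = tr(H^2) = tr(H). *)
Lemma sum_sqr_hat_matrix S :
  \sum_(i < n) \sum_(k < n) hat_matrix S i k ^+ 2 = #|S|%:R.
Proof.
rewrite -mxtrace_hat_matrix -[in RHS]hat_matrix_idem /mxtrace.
apply: eq_bigr => i _; rewrite mxE; apply: eq_bigr => k _.
by rewrite expr2 -[in X in _ = _ * X]trmx_hat_matrix [_^T _ _]mxE.
Qed.

Definition bias S (beta : 'cV[R]_p) : 'cV[R]_n :=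
  (hat_matrix S - 1%:M) *m \col_i dotv (x i) beta.

Lemma residualE S (beta : 'cV[R]_p) (y e : 'I_n -> R) i :
  (forall k, y k = dotv (x k) beta + e k) ->
  dotv (subvec S (x i)) (betahat x S y) - dotv (x i) beta
  = \sum_(k < n) hat_matrix S i k * e k + bias S beta i 0.
Proof.
move=> yE; rewrite hat_matrixE.
under eq_bigr do rewrite yE mulrDr.
rewrite big_split/= addrAC addrC; congr +%R.
rewrite /bias mulmxBl mul1mx [RHS]mxE [X in _ = _ + X]mxE [X in _ = _ - X]mxE.
congr (_ - _); rewrite mxE.
by apply: eq_bigr => k _; rewrite [X in _ = _ * X]mxE.
Qed.

Lemma sum_sqr_bias S (beta : 'cV[R]_p) (sigma : R) : sigma != 0 ->
  \sum_(i < n) bias S beta i 0 ^+ 2 = sigma ^+ 2 * gamma x beta sigma S.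
Proof.
move=> s0; rewrite /gamma mulrCA divff ?mulr1 ?expf_neq0//.
set bc := subvec (~: S) beta.
have mE : \col_i dotv (x i) beta =
    design S *m subvec S beta + design (~: S) *m bc.
  by apply/colP => i; rewrite !mxE (dotv_split S) -!design_mulE !mxE.
have bE : bias S beta = (hat_matrix S - 1%:M) *m design (~: S) *m bc.
  rewrite /bias mE mulmxDr mulmxA mulmxBl hat_matrix_design mul1mx subrr.
  by rewrite mul0mx add0r mulmxA.
have -> : \sum_(i < n) bias S beta i 0 ^+ 2 = dotv (bias S beta) (bias S beta).
  by rewrite dotvE; under eq_bigr do rewrite expr2.
(* The complement of an orthogonal projection is again symmetric and idempotent. *)
have PP :
    (hat_matrix S - 1%:M)^T *m (hat_matrix S - 1%:M) = 1%:M - hat_matrix S.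
  rewrite [X in X *m _]linearB/= trmx_hat_matrix trmx1 mulmxBl mulmxBr.
  by rewrite hat_matrix_idem mul1mx mulmx1 subrr sub0r opprB.
(* [invmx] is an involution, as it fixes singular matrices, so [invmx (Qmat x S)] is the Schur
   complement. In terms of the designs it is the Gram matrix of the columns outside [S] after
   projecting off those in [S]. *)
have QE : n%:R *: invmx (Qmat x S)
    = (design (~: S))^T *m (1%:M - hat_matrix S) *m design (~: S).
  have S10E : Sigma10 x S = n%:R^-1 *: ((design (~: S))^T *m design S).
    by rewrite /Sigma10 /Sigma01 submat_SigmaE linearZ/= trmx_mul trmxK.
  rewrite /Qmat invmxK S10E /Sigma11 /Sigma01 !submat_SigmaE.
  rewrite mulmxBr mulmx1 mulmxBl scalerBr scalerA divff// scale1r.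
  congr (_ - _); rewrite /hat_matrix -!scalemxAl -!scalemxAr -!scalemxAl.
  by rewrite !scalerA divff// mul1r !mulmxA.
rewrite bE /dotv.
have -> (M : 'M[R]_n) (D : 'M[R]_(n, #|~: S|)) :
    (M *m D *m bc)^T *m (M *m D *m bc) = bc^T *m (D^T *m (M^T *m M) *m D) *m bc.
  by rewrite !trmx_mul !mulmxA.
by rewrite PP -QE -scalemxAr -scalemxAl mxE -mulmxA.
Qed.

End least_squares.

(** * Risk *)

Section has_mean.
Context (d : measure_display) (T : measurableType d) (R : realType).
Context (P : probability T R).

(** Integrability travels with the value because linearity of expectation requires it at every
    step. *)
Definition has_mean (X : T -> R) (m : R) : Prop :=
  X \in Lfun P 1 /\ ('E_P[X] = m%:E)%E.

Lemma has_mean_cst c : has_mean (fun=> c) c.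
Proof. by split; [exact: Lfun_cst|exact: expectation_cst]. Qed.

Lemma has_meanD X Y a b :
  has_mean X a -> has_mean Y b -> has_mean (fun w => X w + Y w) (a + b).
Proof.
move=> [iX EX] [iY EY]; split; first exact: rpredD.
by rewrite expectationD// EX EY.
Qed.

Lemma has_meanZ X a c : has_mean X a -> has_mean (fun w => c * X w) (c * a).
Proof.
move=> [iX EX]; rewrite (_ : (fun w => _) = c \o* X).
  by split; [exact: Lfun_scale|rewrite expectationZl// EX].
by apply/funext => w /=; rewrite mulrC.
Qed.

Lemma has_mean_sum (I : finType) (X : I -> T -> R) (m : I -> R) :
  (forall i, has_mean (X i) (m i)) ->
  has_mean (fun w => \sum_i X i w) (\sum_i m i).
Proof.
move=> Xm; elim: (index_enum I) => [|i s IHs].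
  under eq_fun do rewrite big_nil.
  by rewrite big_nil; exact: has_mean_cst.
by under eq_fun do rewrite big_cons; rewrite big_cons; exact: has_meanD.
Qed.

(** Expanding the square leaves a double sum whose off-diagonal terms have mean zero, a linear term
    of mean zero, and the constant [b ^+ 2]. *)
Lemma has_mean_sqr_affine (n : nat) (e : 'I_n -> T -> R) (s : R)
    (a : 'I_n -> R) (b : R) :
  (forall k, has_mean (e k) 0) ->
  (forall j k, has_mean (fun w => e j w * e k w) (s *+ (j == k))) ->
  has_mean (fun w => (\sum_k a k * e k w + b) ^+ 2)
           (s * \sum_k a k ^+ 2 + b ^+ 2).
Proof.
move=> e1 e2.
have -> : (fun w => (\sum_k a k * e k w + b) ^+ 2) =
    (fun w => \sum_j \sum_k (a j * a k) * (e j w * e k w)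
              + (2 * b * (\sum_k a k * e k w) + b ^+ 2)).
  apply/funext => w; set u := \sum_k a k * e k w.
  rewrite (_ : (u + b) ^+ 2 = u * u + (2 * b * u + b ^+ 2)); last by ring.
  congr +%R; rewrite mulr_suml; apply: eq_bigr => j _.
  by rewrite mulr_sumr; apply: eq_bigr => k _; rewrite mulrACA.
apply: has_meanD.
  rewrite mulr_sumr; apply: has_mean_sum => j.
  rewrite (_ : s * _ = \sum_k (a j * a k) * (s *+ (j == k))); last first.
    rewrite (bigD1 j)//= eqxx big1 ?addr0 => [|k /negbTE].
      by rewrite expr2 mulrC.
    by rewrite eq_sym => ->; rewrite mulr0n mulr0.
  by apply: has_mean_sum => k; exact: has_meanZ.
have lin : has_mean (fun w => \sum_k a k * e k w) 0.
  have := has_mean_sum (fun k => has_meanZ (a k) (e1 k)).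
  by rewrite -mulr_suml mulr0.
have := has_meanD (has_meanZ (2 * b) lin) (has_mean_cst (b ^+ 2)).
by rewrite mulr0 add0r.
Qed.

End has_mean.

Section normal_errors.
Context (d : measure_display) (T : measurableType d) (R : realType).
Context (P : probability T R) (n : nat) (sigma : R).
Context (eps : 'I_n -> {RV P >-> R}).
Hypothesis sigma0 : sigma != 0.
Hypothesis heps : iid_normal 0 sigma eps.

Let Lfun2_eps k : (eps k : T -> R) \in Lfun P 2%:E.
Proof. exact: normal_Lfun2 sigma0 (heps.2 k). Qed.

Lemma has_mean_normal_error k : has_mean P (eps k) 0.
Proof.
by split; [exact: normal_Lfun1 (heps.2 k)|exact: expectation_normal (heps.2 k)].
Qed.

Lemma has_mean_normal_errorM j k :
  has_mean P (fun w => eps j w * eps k w) (sigma ^+ 2 *+ (j == k)).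
Proof.
split; first exact: Lfun2_mul_Lfun1.
have [<-|jk] := eqVneq j k.
  under eq_fun do rewrite -expr2.
  by rewrite (expectation_sqr_normal sigma0 (heps.2 j)).
rewrite [LHS]expectationM_indep.
- by rewrite (has_mean_normal_error j).2 mul0e.
- move=> A B mA mB.
  (* Mutual independence is specialised to the pair of indices, with [A] assigned to [j] and [B] to
     [k]. *)
  have := heps.1 [set j; k]%SET (fun i => if i == j then A else B).
  rewrite big_setU1 ?inE//= big_set1 eqxx eq_sym (negbTE jk) => <-; last first.
    by move=> i; case: ifP.
  congr (P _); apply/seteqP; split => [w [Aw Bw] i /=|w AB].
    by rewrite !inE => /orP[] /eqP->; rewrite ?eqxx// eq_sym (negbTE jk).
  split; first by have := AB j; rewrite /= !inE !eqxx; exact.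
  by have := AB k; rewrite /= !inE eqxx orbT eq_sym (negbTE jk); exact.
- exact: (has_mean_normal_error j).1.
- exact: (has_mean_normal_error k).1.
- exact: Lfun2_mul_Lfun1.
Qed.

Lemma risk_normalE (p : nat) (x : 'I_n -> 'cV[R]_p) (beta : 'cV[R]_p)
    (y : 'I_n -> T -> R) (S : {set 'I_p}) :
  (0 < n)%N -> \rank (Sigma x) = p ->
  (forall i w, y i w = dotv (x i) beta + eps i w) ->
  risk P x beta y S
  = (sigma ^+ 2 / n%:R * (#|S|%:R + gamma x beta sigma S))%:E.
Proof.
move=> n0 hx yE; rewrite /risk.
under eq_fun do under eq_bigr do rewrite (residualE S _ (fun k => yE k _)).
(* The target value is brought to [n%:R^-1] times a sum over [i] of variance plus squared bias, the
   mean of each squared residual. *)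
rewrite -mulrA [n%:R^-1 * _]mulrC mulrA mulrDr.
rewrite -(sum_sqr_hat_matrix n0 hx) -(sum_sqr_bias n0 hx)//.
rewrite mulr_sumr -big_split/= mulrC.
have resid i := has_mean_sqr_affine (hat_matrix x S i) (bias x S beta i 0)
  has_mean_normal_error has_mean_normal_errorM.
exact: (has_meanZ n%:R^-1 (has_mean_sum resid)).2.
Qed.

End normal_errors.

Lemma gamma_setT (R : realType) (n p : nat) (x : 'I_n -> 'cV[R]_p)
  (beta : 'cV[R]_p) (sigma : R) : gamma x beta sigma [set: 'I_p]%SET = 0.
Proof.
rewrite /gamma dotvE big1 ?mulr0 ?mul0r// => i.
by have := enum_valP i; rewrite !inE.
Qed.

Theorem mainTheorem5 (R : realType) (d : measure_display)
    (T : measurableType d) (P : probability T R) (n p : nat)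
    (hp : (1 <= p)%N) (hn : (p <= n)%N)
    (x : 'I_n -> 'cV[R]_p) (hx : \rank (Sigma x) = p)
    (beta : 'cV[R]_p) (sigma : R) (hsigma : 0 < sigma)
    (eps : 'I_n -> {RV P >-> R}) (heps : iid_normal 0 sigma eps)
    (y : 'I_n -> T -> R)
    (hy : forall (i : 'I_n) (w : T), y i w = dotv (x i) beta + eps i w)
    (S : {set 'I_p}) :
  rr P x beta y S
    = ((#|S|%:R + gamma x beta sigma S) / p%:R)%:E
  /\ ((risk P x beta y S <= risk_wide P x beta y)%E
      <-> gamma x beta sigma S <= p%:R - #|S|%:R).
Proof.
have n0 : (0 < n)%N := leq_trans hp hn.
have s0 : sigma != 0 by rewrite gt_eqF.
have c0 : 0 < sigma ^+ 2 / n%:R by rewrite divr_gt0 ?exprn_gt0 ?ltr0n.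
have p0 : p%:R != 0 :> R by rewrite pnatr_eq0 -lt0n.
(* Both risks carry the positive factor [sigma ^+ 2 / n%:R], which cancels in the comparison and in
   the quotient. *)
rewrite /rr /risk_wide !(risk_normalE s0 heps _ n0 hx hy) gamma_setT addr0.
rewrite cardsT card_ord; split; last first.
  by rewrite lee_fin ler_pM2l// lerBrDl.
(* The wide risk is a nonzero real, so its extended inverse is the real one. *)
rewrite inver mulf_eq0 (negbTE p0) gt_eqF//= -EFinM invfM mulrACA.
by rewrite divff ?gt_eqF// mul1r.
Qed.
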